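(* Let $n\ge 3$ and let $G=K_{n+1}-\{e_1\}$ be the graph obtained from the complete graph $K_{n+1}$ on $\{0,1,\dots,n\}$ (root $0$) by deleting the edge $e_1=(1,n)$ joining $1$ and $n$. Then the map $\phi_G:\mathrm{sPF}(G)\longrightarrow\mathcal{U}_n'$ induced by the DFS burning algorithm is a bijection.
   Context: $\mathbb{N}=\{0,1,2,\dots\}$, $[n]=\{1,\dots,n\}$, $V=\{0,1,\dots,n\}$. Spherical parking functions: let $R=\mathbb{K}[x_1,\dots,x_n]$ over a field $\mathbb{K}$. For an undirected loopless graph $G$ on $V$ with $a_{ij}$ edges between $i$ and $j$, and $\emptyset\ne A\subseteq[n]$, put $d_A(i)=\sum_{j\in V\setminus A}a_{ij}$ and $m_A=\prod_{i\in A}x_i^{d_A(i)}$. Let $\mathcal{M}_G=\langle m_A:\emptyset\neq A\subseteq[n]\rangle$ and $\mathcal{M}_G^{(k)}=\langle m_A:\emptyset\ne A\subseteq[n],\ |A|\le k+1\rangle$ for $0\le k\le n-1$. Then $\mathrm{sPF}(G)=\{\mathcal{P}\in\mathbb{N}^n:\ \mathbf{x}^{\mathcal{P}}\in\mathcal{M}_G\setminus\mathcal{M}_G^{(n-2)}\}$; elements are viewed as functions $\mathcal{P}:[n]\to\mathbb{N}$. For $\mathcal{P}\in\mathrm{sPF}(G)$, $\mathbf{x}^{\mathcal P}$ is divisible by $m_{[n]}$, and the reduced function $\widetilde{\mathcal{P}}$ is defined by $\mathbf{x}^{\widetilde{\mathcal{P}}}=\mathbf{x}^{\mathcal{P}}/m_{[n]}$,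 i.e. $\widetilde{\mathcal{P}}(i)=\mathcal{P}(i)-a_{0i}$ (here $a_{0i}=1$ for all $i$). Uprooted trees: a rooted labelled tree on $[n]$ is uprooted if its root is larger than all children of the root. $\mathcal{U}_n'$ is the set of uprooted trees on $[n]$ in which $1$ and $n$ are not adjacent; equivalently, the uprooted spanning trees of $G-\{0\}$. DFS burning algorithm: for a simple graph $H$ with totally ordered vertices, a root $r$, and a function $\mathcal{Q}:V(H)\setminus\{r\}\to\mathbb{N}$, initially only $r$ is burnt and the set of tree edges is empty; run $\mathrm{dfs}(r)$, where $\mathrm{dfs}(i)$ is: for each neighbour $j$ of $i$ in $H$, in decreasing order, if $j$ is not burnt at that moment, then: if the current value $\mathcal{Q}(j)=0$, declare $j$ burnt, add edge $(i,j)$ to the tree edges and run $\mathrm{dfs}(j)$; otherwise (the edge is dampened) replace $\mathcal{Q}(j)$ by $\mathcal{Q}(j)-1$. If all vertices become burnt, the tree edges form a spanning tree $\phi(\mathcal{Q})$ of $H$, rooted at $r$. The map $\phi_G$: for $\mathcal{P}\in\mathrm{sPF}(G)$ let $r$ be the largest vertex in $[n]$ with $\widetilde{\mathcal{P}}(r)=0$, let $\widehat{\mathcal{P}}=\widetilde{\mathcal{P}}|_{[n]\setminus\{r\}}$, and let $\phi_G(\mathcal{P})=\phi(\widehat{\mathcal{P}})$ be the tree rooted at $r$ obtained by applying the DFS burning algorithm to $\widehat{\mathcal{P}}$ on the graph $G-\{0\}$ (on $[n]$) with root $r$. *)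

(* Defs.v *)
From HB Require Import structures.
From mathcomp Require Import all_boot all_order all_algebra.
From mathcomp Require Import mpoly.

Set Implicit Arguments.
Unset Strict Implicit.
Unset Printing Implicit Defensive.

Import GRing.Theory.

(* The vertex set V = {0, ..., n} is 'I_n.+1, with root ord0.  The set [n] is
   encoded as 'I_n: the index i : 'I_n, which is also the index of a variable
   of {mpoly K[n]}, stands for the vertex i + 1. *)
Definition vtx (n : nat) (i : 'I_n) : 'I_n.+1 := lift ord0 i.

Record multigraph (n : nat) := Multigraph {
  mult : 'I_n.+1 -> 'I_n.+1 -> nat;
  mult_sym : forall i j, mult i j = mult j i;
  mult_loopless : forall i, mult i i = 0
}.

Section SphericalParkingFunctions.
Variables (n : nat) (G : multigraph n).

Definition outdeg (A : {set 'I_n}) (i : 'I_n) : nat :=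
  \sum_(j : 'I_n.+1 | j \notin [set vtx k | k in A]) mult G (vtx i) j.

(* The exponent vector of the monomial m_A. *)
Definition mexp (A : {set 'I_n}) : 'X_{1..n} :=
  [multinom (if i \in A then outdeg A i else 0) | i < n].

Local Open Scope ring_scope.

Definition in_ideal (R : comNzRingType) (I : finType) (D : pred I) (g : I -> R)
    (p : R) : Prop :=
  exists c : I -> R, p = \sum_(i | D i) c i * g i.

Definition in_M (K : fieldType) (p : {mpoly K[n]}) : Prop :=
  in_ideal (fun A : {set 'I_n} => A != set0) (fun A => 'X_[K, mexp A]) p.

Definition in_Mk (K : fieldType) (k : nat) (p : {mpoly K[n]}) : Prop :=
  in_ideal (fun A : {set 'I_n} => (A != set0) && (#|A| <= k.+1)%N)
    (fun A => 'X_[K, mexp A]) p.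

Definition sPF (K : fieldType) (P : 'X_{1..n}) : Prop :=
  in_M 'X_[K, P] /\ ~ in_Mk (n - 2) 'X_[K, P].

(* Subtraction of exponents is truncated; this is harmless on sPF, where
   m_[n] divides x^P. *)
Definition reduced (P : 'X_{1..n}) : 'X_{1..n} := (P - mexp [set: 'I_n])%MM.

Definition del_root : rel 'I_n := fun i j => (0 < mult G (vtx i) (vtx j))%N.

End SphericalParkingFunctions.

Section RootedTrees.
Variable n : nat.

Record rooted_graph := RootedGraph {
  rg_root : 'I_n;
  rg_edges : {set {set 'I_n}}
}.

Definition adj (E : {set {set 'I_n}}) : rel 'I_n := fun i j => [set i; j] \in E.

Definition is_tree (E : {set {set 'I_n}}) : Prop :=
  [/\ forall e, e \in E -> #|e| = 2,
      forall i j, connect (adj E) i j &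
      forall c : seq 'I_n, 2 < size c -> ~ ucycle (adj E) c].

Definition uprooted_tree (T : rooted_graph) : Prop :=
  is_tree (rg_edges T) /\
  (forall j, adj (rg_edges T) (rg_root T) j -> j < rg_root T).

Definition uprooted_tree' (T : rooted_graph) : Prop :=
  uprooted_tree T /\
  (forall i j : 'I_n, vtx i = 1 :> nat -> vtx j = n :> nat ->
     ~~ adj (rg_edges T) i j).

End RootedTrees.

Section DFSBurning.
Variables (n : nat) (H : rel 'I_n).

Record dfs_state := DfsState {
  burnt : {set 'I_n};
  value : 'I_n -> nat;
  tree_edges : {set {set 'I_n}}
}.

Definition neighbours_decr (i : 'I_n) : seq 'I_n :=
  [seq j <- rev (enum 'I_n) | H i j].

Definition burn (i j : 'I_n) (s : dfs_state) : dfs_state :=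
  DfsState (j |: burnt s) (value s) ([set i; j] |: tree_edges s).

Definition dampen (j : 'I_n) (s : dfs_state) : dfs_state :=
  DfsState (burnt s) [eta value s with j |-> (value s j).-1] (tree_edges s).

(* [fuel] bounds the depth of nested calls.  Each nested call has just burnt a
   new vertex, so any fuel larger than the number of unburnt vertices gives the
   same result; see [dfs_fuel]. *)
Fixpoint dfs (fuel : nat) (i : 'I_n) (s : dfs_state) : dfs_state :=
  if fuel is f.+1 then
    foldl (fun s j =>
             if j \in burnt s then s
             else if value s j == 0 then dfs f j (burn i j s)
             else dampen j s)
          s (neighbours_decr i)
  else s.

Lemma sub_burnt_dfs f i s : burnt s \subset burnt (dfs f i s).
Proof.
elim: f i s => [|f IHf] i s //=.
elim: (neighbours_decr i) s => [|j l IHl] s //=.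
apply: subset_trans (IHl _).
case: ifP => // _; case: ifP => // _.
by apply: subset_trans (IHf _ _); apply: subsetUr.
Qed.

Lemma dfs_fuel f1 f2 i s :
  #|~: burnt s| < f1 -> #|~: burnt s| < f2 -> dfs f1 i s = dfs f2 i s.
Proof.
elim: f1 f2 i s => [|f1 IHf] [|f2] i s //=.
elim: (neighbours_decr i) s => [|j l IHl] s //= lt1 lt2.
case: ifPn => [_|jNs]; first exact: IHl.
case: ifP => _; last exact: IHl.
have lt_b : #|~: burnt (burn i j s)| < #|~: burnt s|.
  apply: proper_card; rewrite properC; apply/properP.
  by split; [exact: subsetUr | exists j; rewrite // !inE eqxx].
rewrite (IHf f2) ?(leq_trans lt_b) //.
have lt_d : #|~: burnt (dfs f2 j (burn i j s))| < #|~: burnt s|.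
  apply: leq_ltn_trans lt_b; apply: subset_leq_card.
  by rewrite setCS sub_burnt_dfs.
by apply: IHl; apply: ltn_trans lt_d _.
Qed.

(* The value of Q at r is never read, since r is burnt from the start, so Q
   stands for its restriction to the vertices other than r.  The result is None
   when some vertex is left unburnt. *)
Definition dfs_burning (r : 'I_n) (Q : 'I_n -> nat) : option (rooted_graph n) :=
  let s := dfs n r (DfsState [set r] Q set0) in
  if burnt s == [set: 'I_n] then Some (RootedGraph r (tree_edges s)) else None.

End DFSBurning.

Definition phi (n : nat) (G : multigraph n) (P : 'X_{1..n}) :
    option (rooted_graph n) :=
  let Q := reduced G P in
  if [pick r : 'I_n | (Q r == 0) && [forall j : 'I_n, (Q j == 0) ==> (j <= r)]]
    is Some r
  then dfs_burning (del_root G) r Q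
  else None.

(* f restricts to a well-defined map from A to B that is a bijection. *)
Definition bijection_between (X Y : Type) (A : X -> Prop) (B : Y -> Prop)
    (f : X -> option Y) : Prop :=
  [/\ forall x, A x -> exists2 y, f x = Some y & B y,
      forall x1 x2, A x1 -> A x2 -> f x1 = f x2 -> x1 = x2 &
      forall y, B y -> exists2 x, A x & f x = Some y].

Section CompleteGraphMinusEdge.
Variable n : nat.

Definition is_e1 (i j : 'I_n.+1) : bool :=
  ((i == 1 :> nat) && (j == n :> nat)) || ((i == n :> nat) && (j == 1 :> nat)).

Definition Kmult (i j : 'I_n.+1) : nat := (i != j) && ~~ is_e1 i j.

Lemma Kmult_sym i j : Kmult i j = Kmult j i.
Proof. by rewrite /Kmult /is_e1 eq_sym orbC [X in _ || X]andbC [X in X || _]andbC. Qed.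

Lemma Kmult_loopless i : Kmult i i = 0.
Proof. by rewrite /Kmult eqxx. Qed.

Definition K_minus_e1 : multigraph n := Multigraph Kmult_sym Kmult_loopless.

End CompleteGraphMinusEdge.

(* Main.v *)
(* The reduced function Q of a spherical parking function satisfies: every
   nonempty proper A contains some i with Q(i) smaller than the number of edges
   of H = G - {0} from i to the complement of A.  With r the largest zero of Q,
   this says exactly that Q is a parking function of H rooted at r.  Counting
   the edges inspected by the burning algorithm shows that these are the
   functions for which everything burns.  A dampened edge never becomes a tree
   edge later, so the run can be replayed from its tree, and Q(j) is the number
   of edges dampened at j during the replay; this inverts the algorithm.  The
   root visits its larger neighbours first, so none of them is its child iff
   Q is positive on all of them. *)
Require Import Defs.
From mathcomp Require Import all_boot all_order all_algebra.
From mathcomp Require Import mpoly.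
From mathcomp Require Import zify.

Set Implicit Arguments.
Unset Strict Implicit.
Unset Printing Implicit Defensive.

Import GRing.Theory.

(** * Runs of the burning algorithm *)

Section BurningRuns.
Variables (n : nat) (H : rel 'I_n).
Implicit Types (i j k r : 'I_n) (l : seq 'I_n) (s t : dfs_state n).
Implicit Types (e : {set 'I_n}) (T E : {set {set 'I_n}}) (A B : {set 'I_n}).

Lemma mem_neighbours_decr i j : (j \in neighbours_decr H i) = H i j.
Proof. by rewrite mem_filter mem_rev mem_enum andbT. Qed.

Lemma uniq_neighbours_decr i : uniq (neighbours_decr H i).
Proof. by rewrite filter_uniq // rev_uniq enum_uniq. Qed.

Definition update (upd : nat -> nat) j s :=
  DfsState (burnt s) [eta value s with j |-> upd (value s j)] (tree_edges s).

(* Big-step semantics of the loop of [dfs i] over the remaining neighbours [l].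
   With [value_zero] and [predn] it is the burning algorithm; with [in_tree T]
   and [succn] it traverses the tree T and counts the dampened edges. *)
Inductive run (dec : dfs_state n -> 'I_n -> 'I_n -> bool) (upd : nat -> nat) :
    'I_n -> seq 'I_n -> dfs_state n -> dfs_state n -> Prop :=
| RunNil i s : run dec upd i [::] s s
| RunSkip i j l s s' : j \in burnt s -> run dec upd i l s s' ->
    run dec upd i (j :: l) s s'
| RunBurn i j l s s1 s' : j \notin burnt s -> dec s i j ->
    run dec upd j (neighbours_decr H j) (burn i j s) s1 ->
    run dec upd i l s1 s' -> run dec upd i (j :: l) s s'
| RunDampen i j l s s' : j \notin burnt s -> ~~ dec s i j ->
    run dec upd i l (update upd j s) s' -> run dec upd i (j :: l) s s'.

Definition value_zero s (i j : 'I_n) : bool := value s j == 0.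
Definition in_tree T s i j : bool := [set i; j] \in T.

Lemma unburnt_burn i j s :
  j \notin burnt s -> #|~: burnt (burn i j s)| < #|~: burnt s|.
Proof.
move=> jNs; apply: proper_card; rewrite properC; apply/properP.
by split; [exact: subsetUr | exists j; rewrite // !inE eqxx].
Qed.

(** * Runs with an arbitrary decision rule and value update *)

Section AnyRun.
Variables (dec : dfs_state n -> 'I_n -> 'I_n -> bool) (upd : nat -> nat).
Local Notation run := (run dec upd).

Lemma run_burnt i l s s' : run i l s s' -> burnt s \subset burnt s'.
Proof.
elim=> {i l s s'} // i j l s s1 s' _ _ _ IH1 _ IH2.
by apply: subset_trans IH2; apply: subset_trans IH1; apply: subsetUr.
Qed.

Lemma run_edges i l s s' : run i l s s' -> tree_edges s \subset tree_edges s'.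
Proof.
elim=> {i l s s'} // i j l s s1 s' _ _ _ IH1 _ IH2.
by apply: subset_trans IH2; apply: subset_trans IH1; apply: subsetUr.
Qed.

Lemma run_nil i s s' : run i [::] s s' -> s' = s.
Proof. by move=> R; inversion R. Qed.

Lemma run_cons i j l s s' : run i (j :: l) s s' ->
  if j \in burnt s then run i l s s'
  else if dec s i j then
    exists2 s1, run j (neighbours_decr H j) (burn i j s) s1 & run i l s1 s'
  else run i l (update upd j s) s'.
Proof.
move=> R; inversion R as [|? ? ? ? ? js R1|? ? ? ? s1 ? js d R1 R2|? ? ? ? ? js d R1].
- by rewrite js.
- by rewrite (negPf js) d; exists s1.
- by rewrite (negPf js) (negPf d).
Qed.

Lemma run_det i l s s1 s2 : run i l s s1 -> run i l s s2 -> s1 = s2.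
Proof.
move=> R1; elim: R1 s2 => {i l s s1}.
- by move=> i s s2 /run_nil.
- by move=> i j l s s1 js _ IH s2 /run_cons; rewrite js => /IH.
- move=> i j l s s1 s' jNs d _ IH1 _ IH2 s2 /run_cons.
  by rewrite (negPf jNs) d => -[s3 /IH1 <- /IH2].
- move=> i j l s s' jNs d _ IH s2 /run_cons.
  by rewrite (negPf jNs) (negPf d) => /IH.
Qed.

(** Termination: a nested call starts with one more burnt vertex, so [f] bounds the nesting depth,
    and within one loop the list [l] shrinks. *)
Lemma run_exists f i l s :
  #|~: burnt s| < f -> exists s', run i l s s'.
Proof.
elim: f i l s => // f IHf i l; elim: l => [|j l IHl] s lt_f.
  by exists s; apply: RunNil.
case: (boolP (j \in burnt s)) => js.
  by have [s' R] := IHl _ lt_f; exists s'; apply: RunSkip.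
case: (boolP (dec s i j)) => d; last first.
  by have [s' R] := IHl (update upd j s) lt_f; exists s'; apply: RunDampen.
have lt1 := leq_trans (unburnt_burn i js) (lt_f : #|~: burnt s| <= f).
have [s1 R1] := IHf j (neighbours_decr H j) _ lt1.
have [|s' R] := IHl s1; last by exists s'; apply: RunBurn R1 R.
apply: leq_ltn_trans lt_f; rewrite subset_leq_card // setCS.
by apply: subset_trans (run_burnt R1); apply: subsetUr.
Qed.

Lemma run_invariant (I : dfs_state n -> Prop) i l s s' :
    (forall s i j, I s -> i \in burnt s -> j \notin burnt s -> H i j ->
       dec s i j -> I (burn i j s)) ->
    (forall s j, I s -> j \notin burnt s -> I (update upd j s)) ->
  run i l s s' -> {subset l <= H i} -> i \in burnt s -> I s -> I s'.
Proof.
move=> Iburn Iupd; elim=> {i l s s'} //.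
- move=> i j l s s' _ _ IH sub; apply: IH => k kl.
  by apply: sub; rewrite inE kl orbT.
- move=> i j l s s1 s' jNs d R1 IH1 _ IH2 sub is1 Is; apply: IH2.
  + by move=> k kl; apply: sub; rewrite inE kl orbT.
  + by apply: (subsetP (run_burnt R1)); rewrite !inE is1 orbT.
  + apply: IH1; first by move=> k; rewrite mem_neighbours_decr.
      by rewrite !inE eqxx.
    by apply: Iburn => //; apply: sub; rewrite mem_head.
- move=> i j l s s' jNs _ _ IH sub is1 Is; apply: IH => //.
    by move=> k kl; apply: sub; rewrite inE kl orbT.
  exact: Iupd.
Qed.

(** The loop itself only links [i] to unburnt entries of [l], and a nested call only adds edges
    between vertices unburnt at the start. This tells when an edge can no longer appear. *)
Lemma run_new_edges i l s s' e :
    run i l s s' -> i \in burnt s -> e \in tree_edges s' ->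
  [\/ e \in tree_edges s,
      exists2 j, (j \in l) && (j \notin burnt s) & e = [set i; j] |
      forall k, k \in e -> k \notin burnt s].
Proof.
elim=> {i l s s'}.
- by move=> i s _; constructor 1.
- move=> i j l s s' _ _ IH is1 es; case: (IH is1 es).
  + by constructor 1.
  + move=> [k /andP[kl ks] ->]; constructor 2; exists k => //.
    by rewrite inE kl orbT.
  + by constructor 3.
- move=> i j l s s1 s' jNs _ R1 IH1 R2 IH2 is1 es.
  have sub1 k : k \notin burnt s1 -> k \notin burnt s.
    apply: contra => ks; apply: (subsetP (run_burnt R1)).
    by rewrite !inE ks orbT.
  case: IH2 => //; first by apply: contraLR is1; apply: sub1.
  + move=> es1; case: IH1 => //; first by rewrite !inE eqxx.
    * rewrite !inE => /orP[/eqP->|]; last by constructor 1.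
      by constructor 2; exists j; rewrite ?mem_head.
    * move=> [k /andP[_]]; rewrite !inE negb_or => /andP[_ ks] ->.
      by constructor 3 => m; rewrite !inE => /orP[] /eqP->.
    * move=> dis; constructor 3 => k /dis; rewrite !inE negb_or.
      by case/andP.
  + move=> [k /andP[kl ks] ->]; constructor 2; exists k => //.
    by rewrite inE kl orbT sub1.
  + by move=> dis; constructor 3 => k /dis; apply: sub1.
- move=> i j l s s' _ _ _ IH is1 es; case: (IH is1 es).
  + by constructor 1.
  + move=> [k /andP[kl ks] ->]; constructor 2; exists k => //.
    by rewrite inE kl orbT.
  + by constructor 3.
Qed.

Lemma run_cat i l1 l2 s s' : run i (l1 ++ l2) s s' ->
  exists2 s1, run i l1 s s1 & run i l2 s1 s'.
Proof.
elim: l1 s => [|j l1 IH] s /= R; first by exists s => //; apply: RunNil.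
move: R => /run_cons; case: ifPn => js; [|case: ifPn => d].
- by move/IH=> [s1 R1 R2]; exists s1 => //; apply: RunSkip.
- by move=> [s2 Rb /IH[s1 R1 R2]]; exists s1 => //; apply: RunBurn Rb R1.
- by move/IH=> [s1 R1 R2]; exists s1 => //; apply: RunDampen.
Qed.

End AnyRun.

Local Notation qrun := (run value_zero predn).
Local Notation trun T := (run (in_tree T) succn).

Lemma dfs_run f i s : #|~: burnt s| < f ->
  qrun i (neighbours_decr H i) s (Defs.dfs H f i s).
Proof.
elim: f i s => // f IHf i s /=.
elim: (neighbours_decr H i) s => [|j l IHl] s lt_f /=; first exact: RunNil.
case: ifPn => js; first by apply: RunSkip => //; apply: IHl.
case: ifPn => v0; last by apply: RunDampen => //; apply: IHl.
have lt1 := leq_trans (unburnt_burn i js) (lt_f : #|~: burnt s| <= f).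
apply: RunBurn (IHf _ _ lt1) _ => //; apply: IHl.
apply: leq_ltn_trans lt_f; rewrite subset_leq_card // setCS.
by apply: subset_trans (sub_burnt_dfs _ _ _ _); apply: subsetUr.
Qed.

(** * Counting inspected edges: complete burning and parking functions *)

Definition edges_from B j := \sum_(k in B) H k j.

Lemma edges_from1 k j : edges_from [set k] j = H k j.
Proof. by rewrite /edges_from big_set1. Qed.

Lemma edges_fromU1 k B j :
  k \notin B -> edges_from (k |: B) j = H k j + edges_from B j.
Proof. exact: big_setU1. Qed.

Lemma edges_from_sub A B j : A \subset B -> edges_from A j <= edges_from B j.
Proof.
move=> sAB; rewrite /edges_from [X in _ <= X](big_setID A) /=.
by rewrite (setIidPr sAB) leq_addr.
Qed.

(** Each newly burnt vertex inspects each of its edges once, and inspecting a [j] that stays unburnt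
    lowers its value by one. The term [(j \in l)] is the pending inspection by [i], which is not
    newly burnt. *)
Lemma qrun_value i l s s' j : qrun i l s s' -> uniq l -> j \notin burnt s' ->
  value s j + edges_from (burnt s) j =
  value s' j + (j \in l) + edges_from (burnt s') j.
Proof.
move=> R; elim: R j => {i l s s'}.
- by move=> i s j _ _; rewrite addn0.
- move=> i k l s s' ks R IH j /= /andP[_ Ul] js; rewrite IH // inE.
  by case: eqP => // ejk; rewrite ejk (subsetP (run_burnt R)) in js.
- move=> i k l s s1 s' ks _ R1 IH1 R2 IH2 j /= /andP[_ Ul] js.
  have js1: j \notin burnt s1.
    by apply: contra js; apply: (subsetP (run_burnt R2)).
  have := IH1 j (uniq_neighbours_decr k) js1.
  have := IH2 j Ul js.
  rewrite mem_neighbours_decr edges_fromU1 // inE /=.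
  case: eqP => [ejk|_]; last by lia.
  by rewrite ejk (subsetP (run_burnt R1)) // !inE eqxx in js1.
- move=> i k l s s' ks v R IH j /= /andP[kl Ul] js.
  have := IH j Ul js; rewrite /= inE.
  case: eqP => [->|_]; last by [].
  by move: v; rewrite /value_zero (negPf kl); case: (value s k) => //= m _; lia.
Qed.

(* The slack [d] accounts for the vertices still to be visited by the enclosing
   calls. *)
Lemma qrun_avoids A i l s s' (d : 'I_n -> nat) :
    qrun i l s s' -> uniq l -> burnt s \subset ~: A ->
    (forall j, j \in A -> d j + (j \in l) + edges_from (~: A) j <=
                          value s j + edges_from (burnt s) j) ->
  burnt s' \subset ~: A /\
  (forall j, j \in A -> d j + edges_from (~: A) j <=
                        value s' j + edges_from (burnt s') j).
Proof.
move=> R; elim: R d => {i l s s'}.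
- by move=> i s d _ sA le_v; split=> // j /le_v; rewrite addn0.
- move=> i k l s s' ks R IH d /= /andP[_ Ul] sA le_v; apply: IH => // j jA.
  by apply: leq_trans (le_v j jA); rewrite inE; case: (j == k); case: (j \in l); lia.
- move=> i k l s s1 s' ks v R1 IH1 R2 IH2 d /= /andP[kl Ul] sA le_v.
  have kA : k \notin A.
    apply/negP => /[dup] kA /le_v; rewrite (eqP v) mem_head.
    by have := edges_from_sub k sA; lia.
  have [||sA1 le_v1] := IH1 (fun j => d j + (j \in l)) (uniq_neighbours_decr k).
  + by rewrite subUset sub1set inE kA.
  + move=> j jA; rewrite mem_neighbours_decr edges_fromU1 //=.
    have := le_v j jA; rewrite inE; case: eqP => [ejk|_ /=]; last by lia.
    by rewrite -ejk jA in kA.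
  exact: IH2.
- move=> i k l s s' ks v R IH d /= /andP[kl Ul] sA le_v; apply: IH => // j jA.
  have := le_v j jA; rewrite /= inE; case: eqP => [->|_] //=.
  by rewrite (negPf kl); move: v; rewrite /value_zero; case: (value s k) => //= m _; lia.
Qed.

(** The usual parking functions of [H] with sink [r]. *)
Definition parking r (Q : 'I_n -> nat) :=
  forall A, A != set0 -> r \notin A ->
    exists2 i, i \in A & Q i < edges_from (~: A) i.

(** Dhar's argument: a vertex left unburnt was dampened along every edge from the burnt set, so a
    nonempty unburnt set would violate [parking]. *)
Lemma parking_burns r Q s' :
    qrun r (neighbours_decr H r) (DfsState [set r] Q set0) s' ->
  parking r Q -> burnt s' = setT.
Proof.
move=> R pQ; apply/eqP; rewrite -subTset -setC0 -setCS setCK.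
apply: contraT; rewrite subset0 => /pQ[|i].
  by rewrite inE negbK (subsetP (run_burnt R)) // inE.
rewrite setCK inE => is'.
have := qrun_value R (uniq_neighbours_decr r) is'.
by rewrite /= mem_neighbours_decr edges_from1; lia.
Qed.

(** A set violating the condition is never entered: each of its vertices has too few edges from
    outside to be inspected at value zero. *)
Lemma burns_parking r Q s' :
    qrun r (neighbours_decr H r) (DfsState [set r] Q set0) s' ->
  burnt s' = setT -> parking r Q.
Proof.
move=> R bT A An0 rA; apply/exists_inP; apply: contraT.
rewrite negb_exists_in => /forall_inP leQ.
have [||] := qrun_avoids (A := A) (d := fun=> 0) R (uniq_neighbours_decr r).
- by rewrite sub1set inE.
- move=> j jA; rewrite /= mem_neighbours_decr edges_from1.
  by have := leQ j jA; rewrite -leqNgt; lia.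
by rewrite bT subTset -[setT]setC0 (inj_eq (@setC_inj _)) (negPf An0).
Qed.

(** * Children of the root and positivity of Q *)

Lemma qrun_dampens i l s s' : qrun i l s s' -> uniq l ->
    (forall j, j \in l -> 0 < value s j) ->
  burnt s' = burnt s /\ tree_edges s' = tree_edges s.
Proof.
elim=> {i l s s'} //.
- move=> i k l s s' _ _ IH /= /andP[_ Ul] pos; apply: IH => // j jl.
  by apply: pos; rewrite inE jl orbT.
- move=> i k l s s1 s' _ v _ _ _ _ _ /(_ k (mem_head _ _)).
  by rewrite (eqP v).
- move=> i k l s s' _ _ _ IH /= /andP[kl Ul] pos; apply: IH => // j jl /=.
  case: eqP => [ejk|_]; first by rewrite -ejk jl in kl.
  by apply: pos; rewrite inE jl orbT.
Qed.

(** With no edge added from [i] to [l], the loop only skips or dampens. As [l] has no repetition,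
    [j] is reached with its initial value and must be dampened there. *)
Lemma qrun_value_gt0 i l s s' : qrun i l s s' -> uniq l ->
    (forall j, j \in l -> [set i; j] \notin tree_edges s') ->
  forall j, j \in l -> j \notin burnt s -> 0 < value s j.
Proof.
elim=> {i l s s'} //.
- move=> i k l s s' ks _ IH /= /andP[_ Ul] noE j.
  rewrite inE => /orP[/eqP->|jl js]; first by rewrite ks.
  by apply: IH => // m ml; apply: noE; rewrite inE ml orbT.
- move=> i k l s s1 s' _ _ R1 _ R2 _ _ /(_ k (mem_head _ _)) /negP[].
  apply: (subsetP (run_edges R2)); apply: (subsetP (run_edges R1)).
  by rewrite !inE eqxx.
- move=> i k l s s' _ v _ IH /= /andP[kl Ul] noE j.
  rewrite inE => /orP[/eqP->|jl js]; first by rewrite lt0n.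
  have := IH Ul _ j jl js; rewrite /=; case: eqP => [ejk|_ ->] //.
    by rewrite -ejk jl in kl.
  by move=> m ml; apply: noE; rewrite inE ml orbT.
Qed.

Lemma neighbours_decr_split i r : neighbours_decr H i =
  [seq j : 'I_n <- neighbours_decr H i | r < j] ++
  [seq j : 'I_n <- neighbours_decr H i | j <= r].
Proof.
have: pairwise (fun j k : 'I_n => k < j) (neighbours_decr H i).
  rewrite pairwise_filter // -sorted_pairwise; last by move=> y x z /= xy yz; lia.
  rewrite rev_sorted; have := iota_ltn_sorted 0 n.
  by rewrite -val_enum_ord sorted_map.
elim: (neighbours_decr H i) => //= j l IHl /andP[/allP lt_j /IHl {}IHl].
case: ltnP => [_|le_jr]; first by rewrite {1}IHl.
have le_l k : k \in l -> k <= r by move/lt_j => /=; lia.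
rewrite (@eq_in_filter _ _ pred0) ?filter_pred0; last first.
  by move=> k /le_l; rewrite leqNgt => /negPf.
by rewrite (@eq_in_filter _ _ predT) ?filter_predT //= => k /le_l.
Qed.

(** The first half of the loop, over the larger neighbours, only dampens, so every tree edge at [r]
    comes from the second half. *)
Lemma root_children_lt r Q s' :
    irreflexive H ->
    qrun r (neighbours_decr H r) (DfsState [set r] Q set0) s' ->
    (forall j, r < j -> 0 < Q j) ->
  forall j, adj (tree_edges s') r j -> j < r.
Proof.
move=> Hirr; rewrite (neighbours_decr_split r r) => /run_cat[s1 R1 R2] pos j.
have [||b1 e1] := qrun_dampens R1.
- by rewrite filter_uniq // uniq_neighbours_decr.
- by move=> k; rewrite mem_filter => /andP[/pos].
have rs1: r \in burnt s1 by rewrite b1 inE.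
rewrite /adj => /(run_new_edges R2 rs1); rewrite e1 inE; case=> //.
- move=> [k]; rewrite mem_filter mem_neighbours_decr -andbA.
  move=> /and3P[le_kr Hrk _] ee.
  have ne_kr : k != r by apply: contraTneq Hrk => ->; rewrite Hirr.
  have: k \in [set r; j] by rewrite ee !inE eqxx orbT.
  rewrite !inE (negPf ne_kr) /= => /eqP <-.
  by rewrite ltn_neqAle le_kr andbT -(inj_eq val_inj) in ne_kr *.
- by move=> /(_ r); rewrite !inE eqxx rs1 => /(_ isT).
Qed.

Lemma root_children_lt_value r Q s' :
    qrun r (neighbours_decr H r) (DfsState [set r] Q set0) s' ->
    (forall j, adj (tree_edges s') r j -> j < r) ->
  forall j, H r j -> r < j -> 0 < Q j.
Proof.
rewrite (neighbours_decr_split r r) => /run_cat[s1 R1 R2] lt_r j Hrj rj.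
apply: (qrun_value_gt0 R1).
- by rewrite filter_uniq // uniq_neighbours_decr.
- move=> k; rewrite mem_filter => /andP[rk _].
  apply/negP => /(subsetP (run_edges R2)) /lt_r.
  by rewrite ltnNge (ltnW rk).
- by rewrite mem_filter rj mem_neighbours_decr.
- by rewrite inE; apply: contraTneq rj => ->; rewrite ltnn.
Qed.

(** * Replaying a run along its tree *)

Lemma trun_value_mono T i l t t' j : trun T i l t t' -> value t j <= value t' j.
Proof.
elim=> {i l t t'} //.
- by move=> i k l t t1 t' _ _ _ /= le1 _; apply: leq_trans.
- move=> i k l t t' _ _ _; apply: leq_trans => /=.
  by case: eqP => [->|].
Qed.

Lemma trun_value_burnt T i l t t' j :
  trun T i l t t' -> j \in burnt t -> value t' j = value t j.
Proof.
elim=> {i l t t'} //.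
- move=> i k l t t1 t' _ _ R1 IH1 _ IH2 jt.
  have jb : j \in burnt (burn i k t) by rewrite !inE jt orbT.
  by rewrite IH2 ?IH1 // (subsetP (run_burnt R1)).
- move=> i k l t t' kt _ _ IH jt; rewrite IH //=.
  by case: eqP => // ejk; rewrite -ejk jt in kt.
Qed.

(** A vertex burnt during the run inspects all its [H]-neighbours, hence all its [T]-neighbours.
    Vertices burnt earlier are excluded, as their own loops may be unfinished. *)
Lemma trun_closed T i l t t' : trun T i l t t' ->
    (forall j k, [set j; k] \in T -> H j k) ->
  (forall j, j \in l -> adj T i j -> j \in burnt t') /\
  (forall j k, j \in burnt t' -> j \notin burnt t -> adj T j k ->
     k \in burnt t').
Proof.
move=> R TH; elim: R => {i l t t'}.
- by move=> i t; split=> // j k ->.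
- move=> i k l t t' kt R [IH1 IH2]; split=> // j.
  rewrite inE => /orP[/eqP-> _|/IH1//].
  exact: (subsetP (run_burnt R)).
- move=> i k l t t1 t' kt d R1 [IH1 IH2] R2 [IH3 IH4].
  have kt1 : k \in burnt t1.
    by apply: (subsetP (run_burnt R1)); rewrite !inE eqxx.
  have sub := subsetP (run_burnt R2).
  split=> [j|j m jt' jt ajm].
    by rewrite inE => /orP[/eqP-> _|/IH3//]; apply: sub.
  case: (boolP (j \in burnt t1)) => jt1; last exact: IH4 ajm.
  apply: sub; case: (eqVneq j k) => [ejk|ne_jk].
    apply: IH1; last by rewrite -ejk.
    by rewrite -ejk mem_neighbours_decr TH.
  by apply: IH2 ajm => //; rewrite !inE (negPf ne_jk).
- move=> i k l t t' kt d R [IH1 IH2]; split=> // j.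
  by rewrite inE => /orP[/eqP-> dT|/IH1//]; rewrite /in_tree -/(adj T i k) dT in d.
Qed.

(* An edge dampened from i to j is never added later: i is already burnt and
   has visited j.  Hence the decisions of the burning algorithm can be read off
   its final tree. *)
Lemma qrun_trun T Q i l s s' t :
    qrun i l s s' -> uniq l -> i \in burnt s ->
    (forall e, e \in tree_edges s -> e \subset burnt s) ->
    tree_edges s' \subset T ->
    (forall e k, e \in T -> k \in e -> k \in burnt s' -> k \notin burnt s ->
       e \in tree_edges s') ->
    (forall j, j \in l -> [set i; j] \in T -> [set i; j] \in tree_edges s') ->
    burnt t = burnt s -> (forall j, value s j + value t j = Q j) ->
  exists2 t', trun T i l t t' &
    burnt t' = burnt s' /\ (forall j, value s' j + value t' j = Q j).
Proof.
move=> R; elim: R t => {i l s s'}.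
- by move=> i s t *; exists t; first exact: RunNil.
- move=> i k l s s' ks R IH t /= /andP[_ Ul] is1 eb sT tou lT bt vt.
  case: (IH t) => // [j jl|t' Rt [b' v']].
    by apply: lT; rewrite inE jl orbT.
  by exists t' => //; apply: RunSkip; rewrite ?bt.
- move=> i k l s s1 s' ks v R1 IH1 R2 IH2 t /= /andP[kl Ul] is1 eb sT tou lT bt vt.
  have sub1 := subsetP (run_burnt R1); have sub2 := subsetP (run_burnt R2).
  have sube1 := subsetP (run_edges R1); have sube2 := subsetP (run_edges R2).
  have ks1 : k \in burnt s1 by apply: sub1; rewrite !inE eqxx.
  have is2 : i \in burnt s1 by apply: sub1; rewrite !inE is1 orbT.
  have ebI : forall s0 i0 j0, (forall e, e \in tree_edges s0 -> e \subset burnt s0) ->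
      i0 \in burnt s0 -> forall e, e \in tree_edges (burn i0 j0 s0) ->
      e \subset burnt (burn i0 j0 s0).
    move=> s0 i0 j0 e0 i0s e; rewrite !inE => /orP[/eqP->|/e0 se].
      by rewrite subUset !sub1set !inE i0s eqxx orbT.
    by apply: subset_trans se _; apply: subsetUr.
  (* Edges of [T] at vertices burnt by the nested call are present when it returns: the rest of the
     loop only adds edges from [i] to vertices still unburnt, or among those. *)
  have key e m : e \in T -> m \in e -> m \in burnt s1 -> m \notin burnt s ->
      e \in tree_edges s1.
    move=> eT me ms1 ms.
    have := tou e m eT me (sub2 _ ms1) ms.
    move=> /(run_new_edges R2 is2); case=> //.
    - move=> [j /andP[_ js1] ee]; move: me; rewrite ee !inE.
      by case/orP=> /eqP em; [rewrite em is1 in ms|rewrite -em ms1 in js1].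
    - by move=> /(_ m me); rewrite ms1.
  have kT : [set i; k] \in T.
    by apply: (subsetP sT); apply: sube2; apply: sube1; rewrite !inE eqxx.
  case: (IH1 (burn i k t)) => [||||e m eT me ms1|j||j|t1 Rt1 [b1 v1]] //.
  + exact: uniq_neighbours_decr.
  + by rewrite !inE eqxx.
  + exact: ebI.
  + by apply: subset_trans sT; apply: run_edges R2.
  + by rewrite !inE negb_or => /andP[_]; apply: key eT me ms1.
  + by move=> _ eT; apply: (key _ k) => //; rewrite !inE eqxx.
  + by rewrite /= bt.
  + exact: vt.
  case: (IH2 t1) => [|||||j jl||j|t' Rt' [b' v']] //.
  + apply: (run_invariant (I := fun s => forall e, e \in tree_edges s ->
      e \subset burnt s)) R1 _ _ _ => [s0 i0 j0 e0 i0s _ _ _|//|j||].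
    * exact: ebI.
    * by rewrite mem_neighbours_decr.
    * by rewrite !inE eqxx.
    * exact: ebI.
  + move=> e m eT me ms' ms1; apply: tou eT me ms' _.
    by apply: contra ms1 => ms; apply: sub1; rewrite !inE ms orbT.
  + by apply: lT; rewrite inE jl orbT.
  by exists t' => //; apply: RunBurn Rt1 Rt'; rewrite ?bt.
- move=> i k l s s' ks v R IH t /= /andP[kl Ul] is1 eb sT tou lT bt vt.
  (* The edge is absent now because [k] is unburnt, and it cannot come later: [k] does not recur in
     [l], and [i] is already burnt. *)
  have kT : [set i; k] \notin T.
    apply/negP => /(lT k (mem_head _ _)) /(run_new_edges R is1); case.
    + by move=> /eb /subsetP /(_ k); rewrite !inE eqxx orbT (negPf ks) => /(_ isT).
    + move=> [j /andP[jl _] ee].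
      have: k \in [set i; j] by rewrite -ee !inE eqxx orbT.
      rewrite !inE => /orP[]/eqP ek; first by rewrite ek is1 in ks.
      by rewrite ek jl in kl.
    + by move=> /(_ i); rewrite !inE eqxx /= is1 => /(_ isT).
  case: (IH (update succn k t)) => // [j jl|j|t' Rt [b' v']].
  + by apply: lT; rewrite inE jl orbT.
  + rewrite /=; case: eqP => [->|//]; rewrite -vt.
    by move: v; rewrite /value_zero; case: (value s k) => //= m _; lia.
  by exists t' => //; apply: RunDampen; rewrite ?bt.
Qed.

(** With [Q] the final count, both rules decide alike. When the traversal burns [k], its count is
    final, so the remaining value is 0; when it dampens [k], the count still has to grow, so the
    remaining value is positive. *)
Lemma trun_qrun T Q i l t t' s :
    trun T i l t t' -> burnt s = burnt t -> tree_edges s = tree_edges t ->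
    (forall j, value s j + value t j = Q j) ->
    (forall j, value t' j <= Q j) ->
    (forall j, j \in burnt t' -> j \notin burnt t -> Q j = value t' j) ->
  exists2 s', qrun i l s s' &
    [/\ burnt s' = burnt t', tree_edges s' = tree_edges t' &
        forall j, value s' j + value t' j = Q j].
Proof.
move=> R; elim: R s => {i l t t'}.
- by move=> i t s *; exists s; first exact: RunNil.
- move=> i k l t t' kt R IH s bs es vs leQ eqQ.
  case: (IH s) => // s' Rs P; exists s' => //.
  by apply: RunSkip; rewrite ?bs.
- move=> i k l t t1 t' kt d R1 IH1 R2 IH2 s bs es vs leQ eqQ.
  have sub2 := subsetP (run_burnt R2); have sub1 := subsetP (run_burnt R1).
  have kb : k \in burnt (burn i k t) by rewrite !inE eqxx.
  have v0 : value s k = 0.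
    have := vs k; rewrite eqQ ?sub2 ?sub1 //.
    by rewrite (trun_value_burnt R2) ?sub1 // (trun_value_burnt R1) //=; lia.
  case: (IH1 (burn i k s)) => [|||j|j jt1|s1 Rs1 [b1 e1 v1]] //=.
  + by rewrite bs.
  + by rewrite es.
  + exact: leq_trans (trun_value_mono j R2) (leQ j).
  + rewrite !inE negb_or => /andP[_ jt].
    by rewrite eqQ ?sub2 // (trun_value_burnt R2).
  case: (IH2 s1) => [|||j|j jt' jt1|s' Rs' P] //.
    apply: eqQ => //; apply: contra jt1 => jt.
    by apply: sub1; rewrite !inE jt orbT.
  exists s' => //; apply: RunBurn Rs1 Rs'; first by rewrite bs.
  by rewrite /value_zero v0.
- move=> i k l t t' kt d R IH s bs es vs leQ eqQ.
  have v0 : value s k != 0.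
    have := leQ k; have := trun_value_mono k R; rewrite /= eqxx.
    by have := vs k; lia.
  case: (IH (update predn k s)) => [||j|||s' Rs P] //.
    by rewrite /=; case: eqP => [->|//]; have := vs k; lia.
  by exists s' => //; apply: RunDampen; rewrite ?bs.
Qed.

End BurningRuns.

Local Notation qrun H := (run H (@value_zero _) predn).
Local Notation trun H T := (run H (in_tree T) succn).

(** * Trees *)

Section Trees.
Variable n : nat.
Implicit Types (i j k r : 'I_n) (e : {set 'I_n}) (T E : {set {set 'I_n}}).

Lemma adj_sym E : ssrbool.symmetric (adj E).
Proof. by move=> i j; rewrite /adj setUC. Qed.

Definition acyclic E := forall c : seq 'I_n, 2 < size c -> ~ ucycle (adj E) c.

(** On a cycle through [j] both cyclic neighbours of [j] would be [i], although they are distinct; a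
    cycle avoiding [j] lies in [E]. *)
Lemma acyclic_leaf E i j : i != j -> (forall e, e \in E -> j \notin e) ->
  acyclic E -> acyclic ([set i; j] |: E).
Proof.
move=> ne_ij jE acE c szc cyc.
have adjj k : adj ([set i; j] |: E) j k -> k != j -> k = i.
  rewrite /adj !inE => /orP[/eqP ee ne_kj|/jE]; last by rewrite !inE eqxx.
  have: k \in [set i; j] by rewrite -ee !inE eqxx orbT.
  by rewrite !inE (negPf ne_kj) orbF => /eqP.
case: (boolP (j \in c)) => [/rot_to[m c' rc]|jc].
  have: ucycle (adj ([set i; j] |: E)) (rot m c) by rewrite rot_ucycle.
  have: 2 < size (rot m c) by rewrite size_rot.
  rewrite rc; case: c' {rc} => [|x [|y c']] //= _.
  rewrite /ucycle /= => /andP[/and3P[jx _]].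
  rewrite rcons_path => /andP[_ yj] /and3P[].
  rewrite !inE !negb_or => /and3P[jx' jy jc'] /andP[xy xc'] _.
  have xi : x = i by apply: adjj; rewrite 1?eq_sym.
  have li : last y c' = i.
    apply: adjj; first by rewrite adj_sym.
    have := mem_last y c'; rewrite inE => /orP[/eqP->|lc']; first by rewrite eq_sym.
    by apply: contraNneq jc' => <-.
  have := mem_last y c'; rewrite li -xi inE (negPf xy) /= => xc.
  by rewrite xc in xc'.
case/andP: cyc => cyc Uc; apply: (acE c) => //; apply/andP; split=> //.
apply: (sub_in_cycle (P := mem c)) cyc; last exact/allP.
move=> x y xc yc; rewrite /adj !inE => /orP[/eqP ee|//].
have: j \in [set x; y] by rewrite ee !inE eqxx orbT.
by rewrite !inE => /orP[]/eqP ej; rewrite ej ?xc ?yc in jc.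
Qed.

(** An edge of [T] missing from [E] would close a simple [E]-path between its ends into a cycle of
    [T]. *)
Lemma connected_sub_tree E T :
    is_tree T -> E \subset T -> (forall i j, connect (adj E) i j) -> E = T.
Proof.
move=> [cT _ acT] sET cE; apply/eqP; rewrite eqEsubset sET /=.
apply/subsetP => e eT; apply: contraT => eE.
have /eqP/cards2P[x [y [ne_xy ee]]] := cT e eT; subst e.
have /connectP[p0 p0P yl] := cE x y; subst y.
move: eT eE ne_xy; have [p pP Up _] := shortenP p0P => eT eE ne_xy.
case: (acT (x :: p)).
  (* The path has at least two steps: its ends differ, and a single step would be the missing
     edge. *)
  case: p eT eE ne_xy pP {Up} => [|z [|w p]] //=; first by rewrite eqxx.
  by move=> _ /negPf eE _; rewrite /adj eE.
apply/andP; split=> //=; rewrite rcons_path adj_sym [adj _ _ _]eT andbT.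
by apply: sub_path pP => a b; rewrite /adj => /(subsetP sET).
Qed.

End Trees.

(** * Spanning trees produced by burning, and recovery of Q from the tree *)

Section BurningTrees.
Variables (n : nat) (H : rel 'I_n).
Implicit Types (i j k r : 'I_n) (e : {set 'I_n}) (T E : {set {set 'I_n}}).
Implicit Types (Q : 'I_n -> nat) (s t : dfs_state n).

Lemma run_connected dec upd r i l s s' :
    run H dec upd i l s s' -> {subset l <= H i} -> i \in burnt s ->
    (forall j, j \in burnt s -> connect (adj (tree_edges s)) r j) ->
  forall j, j \in burnt s' -> connect (adj (tree_edges s')) r j.
Proof.
apply: (run_invariant (I := fun s => forall j, j \in burnt s ->
  connect (adj (tree_edges s)) r j)) => // {i l s s'} s i j conn is1 js _ _ k.
have sub : subrel (connect (adj (tree_edges s)))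
                  (connect (adj (tree_edges (burn i j s)))).
  apply: connect_sub => x y xy; apply: connect1.
  by rewrite /adj !inE in xy *; rewrite xy orbT.
rewrite !inE => /orP[/eqP->|ks]; last by apply: sub; apply: conn.
apply: connect_trans (sub _ _ (conn _ is1)) _; apply: connect1.
by rewrite /adj !inE eqxx.
Qed.

Lemma run_spanning dec upd r Q s' :
    run H dec upd r (neighbours_decr H r) (DfsState [set r] Q set0) s' ->
    burnt s' = setT ->
  forall i j, connect (adj (tree_edges s')) i j.
Proof.
move=> R bT i j.
have conn k : connect (adj (tree_edges s')) r k.
  apply: (run_connected (r := r) R); rewrite ?bT ?inE //.
    by move=> m; rewrite mem_neighbours_decr.
  by move=> m; rewrite inE => /eqP->; apply: connect0.
apply: connect_trans (conn j).
by rewrite (sym_connect_sym (@adj_sym _ _)).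
Qed.

(** The inclusion in [burnt s] makes each newly burnt vertex a leaf. The last clause makes the
    dampening count of a burnt vertex equal to its initial value. *)
Definition tree_invariant r s :=
  [/\ forall e, e \in tree_edges s ->
        e \subset burnt s /\ exists2 p, H p.1 p.2 & e = [set p.1; p.2],
      acyclic (tree_edges s) &
      forall j, j \in burnt s -> j != r -> value s j = 0].

Lemma qrun_tree_invariant r Q s' :
    qrun H r (neighbours_decr H r) (DfsState [set r] Q set0) s' ->
  tree_invariant r s'.
Proof.
move=> R; apply: (run_invariant (I := tree_invariant r)) R _ _ _.
- move=> s i j [eS acS vS] is1 js Hij v0; split=> /= [e||k].
  + rewrite !inE => /orP[/eqP->|/eS[eb eH]].
      split; last by exists (i, j).
      by rewrite subUset !sub1set !inE is1 eqxx orbT.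
    by split=> //; apply: subset_trans eb _; apply: subsetUr.
  + apply: acyclic_leaf => //; first by apply: contraNneq js => <-.
    by move=> e /eS[/subsetP eb _]; apply: contra js; apply: eb.
  + by rewrite !inE => /orP[/eqP-> _|]; [apply/eqP|apply: vS].
- move=> s j [eS acS vS] js; split=> //= k ks kr.
  by case: eqP => [ekj|_]; [rewrite -ekj ks in js|apply: vS].
- by move=> k; rewrite mem_neighbours_decr.
- by rewrite inE.
- split=> /= [e||j]; rewrite ?inE //; last by move/eqP->; rewrite eqxx.
  move=> c szc /andP[]; case: c szc => [|x [|y c]] //= _ /andP[].
  by rewrite /adj inE.
Qed.

Lemma adj_neighbours r s i j :
  irreflexive H -> ssrbool.symmetric H -> tree_invariant r s -> adj (tree_edges s) i j -> H i j.
Proof.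
move=> Hirr Hsym [eS _ _] /eS[_ [[a b] /= Hab ee]].
have ne_ab : a != b by apply: contraTneq Hab => ->; rewrite Hirr.
have: a \in [set i; j] by rewrite ee !inE eqxx.
have: b \in [set i; j] by rewrite ee !inE eqxx orbT.
rewrite !inE => /orP[]/eqP eb /orP[]/eqP ea; subst a b; rewrite ?eqxx // in ne_ab *.
by rewrite Hsym.
Qed.

Lemma qrun_is_tree r Q s' : irreflexive H ->
    qrun H r (neighbours_decr H r) (DfsState [set r] Q set0) s' ->
  burnt s' = setT -> is_tree (tree_edges s').
Proof.
move=> Hirr R bT; have [eS acS _] := qrun_tree_invariant R; split=> //.
  move=> e /eS[_ [[a b] /= Hab ->]]; rewrite cards2.
  by case: eqP Hab => // ->; rewrite Hirr.
exact: run_spanning R bT.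
Qed.

(** Replaying each run along its final tree yields counts equal to Q away from [r]; runs along the
    same tree are identical by determinism. *)
Lemma qrun_inj r Q1 Q2 s1 s2 :
    qrun H r (neighbours_decr H r) (DfsState [set r] Q1 set0) s1 ->
    qrun H r (neighbours_decr H r) (DfsState [set r] Q2 set0) s2 ->
    burnt s1 = setT -> burnt s2 = setT -> tree_edges s1 = tree_edges s2 ->
  forall j, j != r -> Q1 j = Q2 j.
Proof.
have main Q s : qrun H r (neighbours_decr H r) (DfsState [set r] Q set0) s ->
    burnt s = setT -> exists2 t,
    trun H (tree_edges s) r (neighbours_decr H r)
      (DfsState [set r] (fun=> 0) set0) t & forall j, j != r -> value t j = Q j.
  move=> R bT.
  have [||||||||t Rt [_ vt]] :=
    qrun_trun (T := tree_edges s) (Q := Q) (t := DfsState [set r] (fun=> 0) set0) R.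
  - exact: uniq_neighbours_decr.
  - by rewrite inE.
  - by move=> e; rewrite inE.
  - by [].
  - by [].
  - by [].
  - by [].
  - by move=> j; rewrite addn0.
  exists t => // j jr; rewrite -vt.
  by have [_ _ ->] := qrun_tree_invariant R; rewrite ?bT ?inE.
move=> R1 R2 b1 b2 ee j jr.
have [t1 Rt1 <- //] := main _ _ R1 b1; have [t2 Rt2 <- //] := main _ _ R2 b2.
by rewrite ee in Rt1; rewrite (run_det Rt1 Rt2).
Qed.

(** The witness counts the dampened edges in the traversal of [T]. Stating it up to [=1] allows a
    reduced exponent vector in place of [Q]. *)
Lemma qrun_surj r T : is_tree T -> (forall i j, adj T i j -> H i j) ->
  exists2 Q, Q r = 0 & forall Q', Q' =1 Q -> exists2 s',
    qrun H r (neighbours_decr H r) (DfsState [set r] Q' set0) s' &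
    burnt s' = setT /\ tree_edges s' = T.
Proof.
move=> treeT TH.
pose t0 : dfs_state n := DfsState [set r] (fun=> 0) set0.
have [t R] := run_exists H (in_tree T) succn r (neighbours_decr H r)
  (ltnSn #|~: burnt t0|).
(* The burnt set contains [r] and is closed under [T]-adjacency, and [T] is connected. *)
have bT : burnt t = setT.
  have [cl1 cl2] := trun_closed R TH.
  have rt : r \in burnt t by apply: (subsetP (run_burnt R)); rewrite inE.
  apply/setP => j; rewrite inE; have [_ /(_ r j)/connectP[p pP ->] _] := treeT.
  have: {in burnt t, forall x y, adj T x y -> y \in burnt t}.
    move=> x xt y xy; case: (eqVneq x r) => [exr|ne_xr].
      by apply: cl1; rewrite ?mem_neighbours_decr -?exr // TH.
    by apply: cl2 xy => //; rewrite inE.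
  by move=> cl; elim: p r rt pP {t0 R cl1 cl2} => //= x p IHp r0 rt /andP[/(cl _ rt)/IHp].
(* Only edges of [T] are added, and they already connect all vertices. *)
have eT : tree_edges t = T.
  apply: connected_sub_tree treeT _ (run_spanning R bT).
  apply: (run_invariant (I := fun s => tree_edges s \subset T)) R _ _ _ => //=.
  - by move=> s i j sT _ _ _ d; rewrite subUset sub1set sT andbT.
  - by move=> k; rewrite mem_neighbours_decr.
  - by rewrite inE.
  - exact: sub0set.
exists (value t).
  by rewrite (trun_value_burnt R) // inE.
move=> Q' eQ; have [|||||s' Rs [bs es _]] :=
  trun_qrun (Q := value t) (s := DfsState [set r] Q' set0) R => //=.
- by move=> j; rewrite addn0.
- by exists s' => //; rewrite bs es.
Qed.

End BurningTrees.

(** * Spherical parking functions of K_{n+1} minus an edge *)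

(** If no generator divides [x^P], every product in the sum has coefficient 0 at [P], while [x^P]
    has coefficient 1. *)
Lemma in_ideal_monomial (K : fieldType) n (I : finType) (D : pred I)
    (m : I -> 'X_{1..n}) (P : 'X_{1..n}) :
  in_ideal D (fun i => 'X_[K, m i]%R) 'X_[K, P]%R <->
  exists2 i, D i & (m i <= P)%MM.
Proof.
split=> [[c Xsum] | [i Di le_mP]].
  have := congr1 (mcoeff P) Xsum; rewrite mcoeffX eqxx raddf_sum /= => sum1.
  apply/exists_inP; apply: contraT; rewrite negb_exists_in => /forall_inP ngt.
  have := oner_neq0 K; rewrite -[(1 : K)%R]/(true%:R)%R sum1 big1 ?eqxx // => i Di.
  rewrite mcoeffM big1 // => k /eqP eP; rewrite mcoeffX; case: eqP => [em|_].
    case/negP: (ngt i Di); apply/mnm_lepP => x.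
    by rewrite em (congr1 (fun q : 'X_{1..n} => q x) eP) mnmDE leq_addl.
  by rewrite mulr0.
exists (fun j => if j == i then 'X_[K, P - m i]%R else 0%R).
rewrite (bigD1 i) //= eqxx big1 ?addr0; last first.
  by move=> j /andP[_ /negPf->]; rewrite mul0r.
by rewrite -mpolyXD submK.
Qed.

Section KminusEdge.
Variable n : nat.
Local Notation G := (K_minus_e1 n).
Local Notation H := (del_root G).
Implicit Types (i j k r : 'I_n) (A : {set 'I_n}) (Q : 'I_n -> nat).
Implicit Types (P : 'X_{1..n}).

(** Indices are shifted by one: vertex 1 has index 0 and vertex n has index n - 1. *)
Lemma del_rootE i j : H i j = (i != j) &&
  ~~ (((i == 0 :> nat) && (j.+1 == n)) || ((i.+1 == n) && (j == 0 :> nat))).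
Proof.
rewrite /del_root /= /Kmult lt0b (inj_eq (@lift_inj _ ord0)).
by rewrite /is_e1 !lift0 !eqSS.
Qed.

Lemma del_root_irr : irreflexive H.
Proof. by move=> i; rewrite del_rootE eqxx. Qed.

Lemma del_root_sym : ssrbool.symmetric H.
Proof. by move=> i j; rewrite /del_root mult_sym. Qed.

(** The successor is the edge to the root 0, which the deletion of (1, n) leaves in place. *)
Lemma outdegE A i : outdeg G A i = (edges_from H (~: A) i).+1.
Proof.
rewrite /outdeg big_mkcond big_ord_recl /=.
have -> : ord0 \notin [set vtx k | k in A].
  by apply/imsetP => -[k _ /(congr1 val)].
have -> : Kmult (vtx i) ord0 = 1.
  rewrite /Kmult /is_e1 /= !andbF orbF.
  by have := ltn_ord i; case: n i => // m i _; rewrite andbF.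
rewrite add1n /edges_from [in RHS]big_mkcond /=; congr _.+1.
apply: eq_bigr => k _; rewrite inE mem_imset ?lift_inj //; last exact: lift_inj.
by case: ifP => // _; rewrite del_root_sym /del_root /= lt0b.
Qed.

Lemma mexpE A i : mexp G A i = (i \in A) * (edges_from H (~: A) i).+1.
Proof. by rewrite mnmE outdegE; case: ifP => _; rewrite ?mul1n. Qed.

Lemma mexpT i : mexp G setT i = 1.
Proof. by rewrite mexpE inE setCT /edges_from big_set0. Qed.

Lemma reducedE P i : reduced G P i = (P i).-1.
Proof. by rewrite mnmBE mexpT subn1. Qed.

(** Equivalently, no [m_A] with [A] nonempty and proper divides the monomial with exponents
    [Q i + 1]. *)
Definition spherical Q := forall A, A != set0 -> A != setT ->
  exists2 i, i \in A & Q i < edges_from H (~: A) i.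

(** The only generator left to divide [x^P] is [m_[n]], the product of all variables, which gives
    positivity. *)
Lemma sPFE (K : fieldType) P : 1 < n ->
  sPF G K P <-> (forall i, 0 < P i) /\ spherical (fun i => (P i).-1).
Proof.
move=> n_gt1; rewrite /sPF /in_M /in_Mk.
have le_mexp A : (forall i, 0 < P i) -> (mexp G A <= P)%MM <->
    ~ exists2 i, i \in A & (P i).-1 < edges_from H (~: A) i.
  move=> P_gt0; split=> [/mnm_lepP le_mP [i iA]|nex].
    by have := le_mP i; rewrite mexpE iA; have := P_gt0 i; lia.
  apply/mnm_lepP => i; rewrite mexpE; case: (boolP (i \in A)) => iA //.
  rewrite mul1n leqNgt; apply/negP => lt_P; apply: nex; exists i => //.
  by have := P_gt0 i; lia.
(* As [1 < n], the subtraction is not truncated and the bound is n - 1. *)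
have small A : (#|A| <= (n - 2).+1) = (A != setT).
  have -> : (n - 2).+1 = n.-1 by lia.
  have := max_card A; have := cardsT 'I_n; rewrite card_ord => cT le_A.
  apply/idP/idP; first by apply: contraTneq => ->; lia.
  rewrite -properT => /proper_card; rewrite cT; lia.
split=> [[/in_ideal_monomial[A An0 le_mP] notMk]|[P_gt0 sph]].
  have AT : A = setT.
    apply/eqP; apply: contraT => AnT; case: notMk; apply/in_ideal_monomial.
    by exists A; rewrite ?An0 ?small.
  have P_gt0 i : 0 < P i.
    by have /mnm_lepP/(_ i) := le_mP; rewrite AT mexpT.
  split=> // B Bn0 BnT; apply/exists_inP; apply: contraT => /exists_inP nex.
  case: notMk; apply/in_ideal_monomial; exists B; first by rewrite Bn0 small.
  exact/le_mexp.
split.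
  apply/in_ideal_monomial; exists setT; last by apply/mnm_lepP => i; rewrite mexpT.
  by rewrite -card_gt0 cardsT card_ord; lia.
move=> /in_ideal_monomial[A /andP[An0]]; rewrite small => AnT /le_mexp[] //.
exact: sph.
Qed.

(** * Choosing the root: spherical against rooted parking functions *)

Definition max_zero Q r := Q r = 0 /\ forall j, Q j = 0 -> j <= r.

(** For the complement of a single vertex [v], the bound is at most one edge, which forces a
    zero. *)
Lemma spherical_max_zero Q : 1 < n -> spherical Q -> exists r, max_zero Q r.
Proof.
move=> n_gt1 sph; pose v : 'I_n := Ordinal (ltnW n_gt1).
have [||i _] := sph (~: [set v]).
- by rewrite -card_gt0 cardsC1 card_ord; lia.
- by rewrite -properT; apply/properP; split; [|exists v; rewrite !inE ?eqxx].
rewrite setCK edges_from1 => Qi; have Qi0 : Q i == 0 by case: (H v i) Qi; lia.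
have [r /eqP Qr max_r] := 
  @arg_maxnP _ i (fun j => Q j == 0) (fun j : 'I_n => j : nat) Qi0.
by exists r; split=> // j /eqP/max_r.
Qed.

Lemma spherical_parking Q r : spherical Q -> parking H r Q.
Proof.
by move=> sph A An0 rA; apply: sph => //; apply: contraNneq rA => ->; rewrite inE.
Qed.

(* Only the vertex n can fail to see the complement of a set containing it, and
   then the complement is {1}; a child of the root n is a zero adjacent to 1. *)
Lemma parking_spherical Q r :
  0 < r -> Q r = 0 -> parking H r Q -> spherical Q.
Proof.
move=> r_gt0 Qr pQ A An0 AnT; case: (boolP (r \in A)) => rA; last exact: pQ.
case: (boolP [exists k in ~: A, H k r]) => [/exists_inP[k kA Hkr]|].
  exists r => //; rewrite Qr /edges_from (bigD1 k) //= Hkr; lia.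
rewrite negb_exists_in => /forall_inP noH.
have nbr k : k \notin A -> r.+1 = n /\ k = 0 :> nat.
  move=> kA; have := noH k; rewrite inE kA => /(_ isT).
  have kr : k != r by apply: contraNneq kA => ->.
  by rewrite del_rootE kr /= negbK; lia.
have [k kA] : exists k, k \notin A.
  have : A \proper setT by rewrite properT.
  by case/properP=> _ [k _ kA]; exists k.
have [rn k0] := nbr k kA.
(* This gives a zero [i] adjacent to [r], the vertex n. Hence [i] is not vertex 1, so it lies in
   [A], and it is adjacent to [k], which is vertex 1. *)
have [||i] := pQ (~: [set r]).
- by apply/set0Pn; exists k; rewrite !inE; apply: contraNneq kA => ->.
- by rewrite !inE eqxx.
rewrite setCK edges_from1 !inE => ir Qi.
have Hri : H r i by case: (H r i) Qi.
have iA : i \in A.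
  apply: contraT => /nbr[_ i0]; move: Hri.
  by rewrite del_rootE; move: i0 rn; lia.
exists i => //; rewrite /edges_from (bigD1 k) ?inE //=.
have -> : H k i.
  have ki : k != i by apply: contraNneq kA => ->.
  rewrite del_rootE ki /= k0; move: ir Hri; rewrite del_rootE -(inj_eq val_inj) /=.
  by move: rn r_gt0; lia.
by rewrite Hri in Qi; lia.
Qed.

(** * The map [phi] and its bijectivity *)

Lemma phiE P r : max_zero (reduced G P) r ->
  phi G P = dfs_burning H r (reduced G P).
Proof.
move=> [Pr max_r]; rewrite /phi; case: pickP => [r' /andP[/eqP Pr' /forallP max_r']|].
  suff -> : r' = r by [].
  apply/val_inj/eqP; rewrite eqn_leq max_r //=.
  by have := max_r' r; rewrite Pr eqxx.
move/(_ r); rewrite Pr eqxx /= => /forallP[] j.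
by apply/implyP => /eqP/max_r.
Qed.

Lemma dfs_burning_run r Q : exists2 s',
  qrun H r (neighbours_decr H r) (DfsState [set r] Q set0) s' &
  dfs_burning H r Q = if burnt s' == setT
                      then Some (RootedGraph r (tree_edges s')) else None.
Proof.
exists (Defs.dfs H n r (DfsState [set r] Q set0)) => //.
(* Initially n - 1 vertices are unburnt, so fuel [n] suffices. *)
apply: dfs_run; rewrite /= cardsC1 card_ord.
by have := ltn_ord r; lia.
Qed.

Lemma phi_sPF (K : fieldType) P : 1 < n -> sPF G K P ->
  exists r s', [/\ max_zero (reduced G P) r,
    qrun H r (neighbours_decr H r) (DfsState [set r] (reduced G P) set0) s',
    burnt s' = setT & phi G P = Some (RootedGraph r (tree_edges s'))].
Proof.
move=> n_gt1 /(sPFE K _ n_gt1)[P_gt0 sph].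
have sphR : spherical (reduced G P).
  by move=> A An0 AnT; have [i iA] := sph A An0 AnT; exists i; rewrite ?reducedE.
have [r mz] := spherical_max_zero n_gt1 sphR.
have [s' R dE] := dfs_burning_run r (reduced G P).
have bT := parking_burns R (spherical_parking (r := r) sphR).
by exists r, s'; split=> //; rewrite (phiE mz) dE bT eqxx.
Qed.

End KminusEdge.

Theorem theorem3p5 (K : fieldType) (n : nat) (hn : 3 <= n) :
  bijection_between (sPF (K_minus_e1 n) K) (@uprooted_tree' n)
    (phi (K_minus_e1 n)).
Proof.
have n_gt1 : 1 < n by apply: ltnW.
pose H := del_root (K_minus_e1 n).
have Hirr : irreflexive H := @del_root_irr n.
have Hsym : ssrbool.symmetric H := @del_root_sym n.
split.
- move=> P /(phi_sPF n_gt1)[r [s' [[Pr max_r] R bT ->]]].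
  exists (RootedGraph r (tree_edges s')) => //; split; [split|].
  + exact: qrun_is_tree Hirr R bT.
  + apply: root_children_lt Hirr R _ => j rj; rewrite lt0n.
    by apply: contraTneq rj => /max_r; rewrite -leqNgt.
  + move=> i j; rewrite /vtx !lift0 => -[i0] jn; apply/negP.
    move=> /(adj_neighbours Hirr Hsym (qrun_tree_invariant R)).
    by rewrite /H del_rootE i0 jn !eqxx /= andbF.
- move=> P1 P2 sP1 sP2.
  have [r1 [s1 [[z1 _] R1 b1 ->]]] := phi_sPF n_gt1 sP1.
  have [r2 [s2 [[z2 _] R2 b2 ->]]] := phi_sPF n_gt1 sP2.
  case=> er es; subst r2.
  have [gt1 _] := (sPFE K P1 n_gt1).1 sP1.
  have [gt2 _] := (sPFE K P2 n_gt1).1 sP2.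
  apply/mnmP => i.
  (* Both reduced functions vanish at the common root, and the tree determines them elsewhere.
     Positive exponents then make the truncated predecessor injective. *)
  have : reduced (K_minus_e1 n) P1 i = reduced (K_minus_e1 n) P2 i.
    case: (eqVneq i r1) => [->|ir]; first by rewrite z1 z2.
    exact: (qrun_inj R1 R2).
  by rewrite !reducedE; have := gt1 i; have := gt2 i; lia.
- move=> [r T] [[/= treeT lt_r] no1n].
  have TH i j : adj T i j -> H i j.
    move=> aij; rewrite /H del_rootE; apply/andP; split.
      have [cT _ _] := treeT; apply/eqP => eij.
      by have := cT _ aij; rewrite eij setUid cards1.
    rewrite negb_or; apply/andP; split; apply/negP => /andP[/eqP ei /eqP ej].
      by case/negP: (no1n i j (congr1 S ei) ej).
    by case/negP: (no1n j i (congr1 S ej) ei); rewrite adj_sym.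
  (* A path to another vertex starts with an edge at [r], whose other end is smaller than [r]. *)
  have r_gt0 : 0 < r.
    pose v : 'I_n := Ordinal n_gt1.
    rewrite lt0n; apply/negP => /eqP r0.
    have [_ /(_ r v)/connectP[[|x p] /= pP vr] _] := treeT.
      by move/(congr1 val): vr; rewrite /= r0.
    by case/andP: pP => /lt_r; rewrite r0.
  have [Q Qr exQ] := qrun_surj r treeT TH.
  (* All exponents of [m_[n]] are 1, so adding 1 everywhere undoes the reduction. *)
  pose P : 'X_{1..n} := [multinom (Q i).+1 | i < n].
  have PE : reduced (K_minus_e1 n) P =1 Q by move=> i; rewrite reducedE mnmE.
  have [s' R [bT es]] := exQ _ PE.
  have mz : max_zero (reduced (K_minus_e1 n) P) r.
    split=> [|j]; first by rewrite PE.
    move=> Pj; rewrite leqNgt; apply/negP => rj.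
    (* Distinct non-adjacent vertices involve index 0, which [0 < r < j] excludes. *)
    have Hrj : H r j by rewrite /H del_rootE -(inj_eq val_inj) /=; lia.
    have := root_children_lt_value R _ Hrj rj.
    by rewrite es Pj => /(_ lt_r).
  have sphR : spherical (reduced (K_minus_e1 n) P).
    by apply: parking_spherical r_gt0 mz.1 (burns_parking R bT).
  exists P.
    apply/(sPFE K P n_gt1); split=> [i|A An0 AnT]; first by rewrite mnmE.
    by have [i iA] := sphR A An0 AnT; exists i; rewrite -?reducedE.
  rewrite (phiE mz); have [s2 R2 ->] := dfs_burning_run r (reduced (K_minus_e1 n) P).
  by rewrite (run_det R2 R) bT eqxx es.
Qed.
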